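(* Let $(\mathfrak{g},\bullet,\langle\;,\;\rangle)$ be a pseudo-Euclidean left Leibniz algebra. Then the following assertions hold. 1. If $(\mathfrak{g},\bullet,\langle\;,\;\rangle)$ is $\mathrm{L}$-quadratic and simple, with core $A$ and $\mathfrak{h}$, then either $\mathrm{Leib}(\mathfrak{g})=\mathrm{Leib}(\mathfrak{g})^\perp$, $A=\{0\}$ and $\mathfrak{h}=\mathrm{Lie}(\mathfrak{g})$; or $\mathrm{Leib}(\mathfrak{g})$ is nondegenerate, $\mathrm{Leib}(\mathfrak{g})^\perp$ is a simple quadratic Lie algebra and $\mathfrak{g}=\mathrm{Leib}(\mathfrak{g})\oplus\mathrm{Leib}(\mathfrak{g})^\perp$. 2. If $(\mathfrak{g},\bullet,\langle\;,\;\rangle)$ is $\mathrm{R}$-quadratic and semi-simple then $(\mathfrak{g},\bullet,\langle\;,\;\rangle)$ is a quadratic Lie algebra.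
   Context: Algebras are real and finite dimensional. Left Leibniz: $u\bullet(v\bullet w)=(u\bullet v)\bullet w+v\bullet(u\bullet w)$. Pseudo-Euclidean means endowed with a metric (nondegenerate symmetric bilinear form). It is $\mathrm{L}$-quadratic (resp. $\mathrm{R}$-quadratic) if all left multiplications $v\mapsto u\bullet v$ (resp. right multiplications $v\mapsto v\bullet u$) are skew-symmetric. A quadratic Lie algebra is a Lie algebra with a metric for which all $\mathrm{ad}_u$ are skew-symmetric. $\mathrm{Leib}(\mathfrak{g})=\mathrm{span}\{u\bullet v+v\bullet u\}$ is an ideal, and $\mathrm{Lie}(\mathfrak{g})=\mathfrak{g}/\mathrm{Leib}(\mathfrak{g})$ is a Lie algebra. A subspace $V$ is nondegenerate if $V\cap V^\perp=\{0\}$. Core of an $\mathrm{L}$-quadratic left Leibniz algebra: put $I=\mathrm{Leib}(\mathfrak{g})\cap\mathrm{Leib}(\mathfrak{g})^\perp$; then $A=I^\perp/I$ with the quotient product and metric induced from $I^\perp$, and $\mathfrak{h}=\mathfrak{g}/I^\perp$ with the quotient product, which is a Lie bracket ($I^\perp$ is an ideal). $\mathfrak{g}$ is simple if its only ideals are $\{0\}$, $\mathrm{Leib}(\mathfrak{g})$ and $\mathfrak{g}$, and $\mathfrak{g}\bullet\mathfrak{g}\neq\mathrm{Leib}(\mathfrak{g})$. $\mathfrak{g}$ is semi-simple if its radical (largest solvable ideal) equals $\mathrm{Leib}(\mathfrak{g})$, equivalently $\mathrm{Lie}(\mathfrak{g})$ is a semi-simple Lie algebra. *)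

(* Defs.v *)
From HB Require Import structures.
From mathcomp Require Import all_boot all_order all_algebra.
From mathcomp Require Import reals.

Set Implicit Arguments.
Unset Strict Implicit.
Unset Printing Implicit Defensive.

Import GRing.Theory.
Local Open Scope ring_scope.

Reserved Notation "u • v" (at level 40, left associativity).

Record algebra (R : realType) := MkAlgebra {
  carrier :> vectType R;
  amul : {bilinear carrier -> carrier -> carrier} }.

Notation "u • v" := (amul _ u v) : ring_scope.

Section Algebras.
Variables (R : realType) (g : algebra R).
Implicit Types (u v w : g) (U V W : {vspace g}).

Definition left_leibniz : Prop :=
  forall u v w, u • (v • w) = (u • v) • w + v • (u • w).

Definition lie_algebra : Prop :=
  (forall u, u • u = 0) /\
  (forall u v w, u • (v • w) + v • (w • u) + w • (u • v) = 0).

(* The span of all products u • v with u in U and v in V; see prodg_subP. *)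
Definition prodg U V : {vspace g} :=
  <<[seq u • v | u <- vbasis U, v <- vbasis V]>>%VS.

(* The span of all u • v + v • u; see Leib_subP. *)
Definition Leib : {vspace g} :=
  <<[seq (u • v + v • u)%R | u <- vbasis (fullv : {vspace g}),
                         v <- vbasis (fullv : {vspace g})]>>%VS.

Definition subalgebra U : Prop := forall u v, u \in U -> v \in U -> u • v \in U.

Definition ideal U : Prop :=
  forall u v, v \in U -> (u • v \in U) /\ (v • u \in U).

(* For a Lie algebra Leib = 0, and this is the usual notion: non-abelian,
   without nontrivial ideals. *)
Definition simple_algebra : Prop :=
  (forall U, ideal U -> [\/ U = 0%VS, U = Leib | U = fullv]) /\
  prodg fullv fullv <> Leib.

Definition solvable U : Prop := exists k, iter k (fun V => prodg V V) U = 0%VS.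

Definition is_radical U : Prop :=
  [/\ ideal U, solvable U & forall V, ideal V -> solvable V -> (V <= U)%VS].

Definition semisimple_algebra : Prop := is_radical Leib.

Lemma prodg_subP U V W :
  (forall u v, u \in U -> v \in V -> u • v \in W) <-> (prodg U V <= W)%VS.
Proof.
split=> [UVW | sUVW u v Uu Vv].
  apply/span_subvP => _ /allpairsP[[u v] [/= Uu Vv ->]].
  by apply: UVW; apply: vbasis_mem.
apply: (subvP sUVW).
rewrite (coord_vbasis Uu) (coord_vbasis Vv) linear_sumlz.
apply: memv_suml => i _; rewrite linear_sumr; apply: memv_suml => j _.
rewrite linearZr linearZl_LR /=.
apply/memvZ/memvZ/memv_span/allpairsP.
by exists ((vbasis U)`_i, (vbasis V)`_j); split; rewrite // mem_nth ?size_tuple.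
Qed.

Lemma Leib_subP W :
  (forall u v, u • v + v • u \in W) <-> (Leib <= W)%VS.
Proof.
split=> [H | sLW u v].
  by apply/span_subvP => _ /allpairsP[[u v] [/= _ _ ->]].
apply: (subvP sLW).
rewrite (coord_vbasis (memvf u)) (coord_vbasis (memvf v)).
rewrite linear_sumlz [X in _ + X]linear_sumr -big_split /=.
apply: memv_suml => i _; rewrite linear_sumr linear_sumlz -big_split /=.
apply: memv_suml => j _.
rewrite !linearZr_LR /= !linearZl_LR /= scalerA mulrC -scalerA -!scalerDr.
apply/memvZ/memvZ/memv_span/allpairsP.
by exists ((vbasis fullv)`_i, (vbasis fullv)`_j); split; rewrite // mem_nth ?size_tuple.
Qed.

End Algebras.

Arguments Leib {R} g.
Arguments lie_algebra {R} g.
Arguments left_leibniz {R} g.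
Arguments simple_algebra {R} g.
Arguments semisimple_algebra {R} g.
Arguments ideal {R g} U.
Arguments subalgebra {R g} U.
Arguments solvable {R g} U.

Section Metric.
Variables (R : realType) (g : algebra R) (B : {symmetric g}).

Definition L_quadratic : Prop := forall u v w : g, B (u • v) w = - B v (u • w).

Definition R_quadratic : Prop := forall u v w : g, B (v • u) w = - B v (w • u).

Definition quadratic_lie_algebra : Prop :=
  [/\ lie_algebra g, nondegenerate B & L_quadratic].

Definition nondegenerate_subspace (V : {vspace g}) : Prop :=
  (V :&: orthov B V = 0)%VS.

End Metric.

Section RestrictForm.
Variables (R : realType) (E : vectType R) (B : {symmetric E}) (V : {vspace E}).

Definition restrict_form (x y : subvs_of V) : R := B (vsval x) (vsval y).

Lemma restrict_form_bilinear :
  bilinear_for (GRing.Scale.Law.clone _ _ *%R _)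
    (GRing.Scale.Law.clone _ _ (idfun \; *%R) _) restrict_form.
Proof.
split=> [y | x] a u v; rewrite /restrict_form (linearP vsval).
  by rewrite linearPl.
by rewrite linearPr.
Qed.

HB.instance Definition _ := bilinear_isBilinear.Build R (subvs_of V) (subvs_of V) R
  _ _ restrict_form restrict_form_bilinear.

Lemma restrict_form_sym x y :
  restrict_form x y = (-1) ^+ false * idfun (restrict_form y x).
Proof. exact: (@hermitian_subproof R E false idfun B). Qed.

HB.instance Definition _ := isHermitianSesquilinear.Build R (subvs_of V) false
  idfun restrict_form restrict_form_sym.

End RestrictForm.

Section Subalgebra.
Variables (R : realType) (g : algebra R) (V : {vspace g}).

(* The restriction of the product to V, meaningful when V is a subalgebra;
   see sub_algebraE. *)
Definition sub_mul (x y : subvs_of V) : subvs_of V := vsproj V (vsval x • vsval y).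

Lemma sub_mul_bilinear :
  bilinear_for (GRing.Scale.Law.clone _ _ *:%R _)
    (GRing.Scale.Law.clone _ _ *:%R _) sub_mul.
Proof.
split=> [y | x] a u v; rewrite /sub_mul (linearP vsval).
  by rewrite linearPl linearP.
by rewrite linearPr linearP.
Qed.

HB.instance Definition _ := bilinear_isBilinear.Build R (subvs_of V) (subvs_of V)
  (subvs_of V) _ _ sub_mul sub_mul_bilinear.

Definition sub_algebra : algebra R := @MkAlgebra R (subvs_of V) sub_mul.

Lemma sub_algebraE (x y : sub_algebra) :
  subalgebra V -> vsval (x • y) = vsval x • vsval y.
Proof. by move=> VV; rewrite /= /sub_mul vsprojK // VV // subvsP. Qed.

Definition sub_form (B : {symmetric g}) : {symmetric sub_algebra} := @restrict_form _ _ B V.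

End Subalgebra.

Arguments sub_algebra {R g} V.
Arguments sub_form {R g} V B.

Section Quotient.
Variables (R : realType) (g : algebra R) (U : {vspace g}).

(* The library has no quotient vector spaces. g / U is modelled on the chosen
   complement U^C: a coset is represented by its unique element in U^C, and
   quot_proj : g -> g / U is the projection along U. It is surjective
   (quot_projK) with kernel U (quot_proj_eq0). *)
Definition quot_space : vectType R := subvs_of U^C.

Definition quot_proj : 'Hom(g, quot_space) :=
  linfun (vsproj U^C \o daddv_pi U^C U).

(* The quotient product, computed on representatives; it does not depend on
   them when U is an ideal (quot_projM). *)
Definition quot_mul (x y : quot_space) : quot_space :=
  quot_proj (vsval x • vsval y).

Lemma quot_mul_bilinear :
  bilinear_for (GRing.Scale.Law.clone _ _ *:%R _)
    (GRing.Scale.Law.clone _ _ *:%R _) quot_mul.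
Proof.
split=> [y | x] a u v; rewrite /quot_mul (linearP vsval).
  by rewrite linearPl linearP.
by rewrite linearPr linearP.
Qed.

HB.instance Definition _ := bilinear_isBilinear.Build R quot_space quot_space
  quot_space _ _ quot_mul quot_mul_bilinear.

Definition quotient : algebra R := @MkAlgebra R quot_space quot_mul.

(* The form induced on g / U, well defined when U is orthogonal to g
   (quot_formE). *)
Definition quot_form (B : {symmetric g}) : {symmetric quotient} :=
  @restrict_form _ _ B U^C.

Lemma quot_projE v : vsval (quot_proj v) = daddv_pi U^C U v.
Proof. by rewrite lfunE /= vsprojK // memv_pi. Qed.

Lemma quot_projK : cancel (vsval : quotient -> g) quot_proj.
Proof.
move=> x; apply: val_inj; rewrite /= quot_projE daddv_pi_id ?subvsP //.
by rewrite capvC capv_compl.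
Qed.

Lemma mem_sub_quot_proj v : v - vsval (quot_proj v) \in U.
Proof.
have UCU0 : (U^C :&: U = 0)%VS by rewrite capvC capv_compl.
rewrite quot_projE -{1}(daddv_pi_add (w := v) UCU0).
  by rewrite addrAC subrr add0r memv_pi.
by rewrite addvC addv_complf memvf.
Qed.

Lemma quot_proj_eq0 v : (quot_proj v == 0) = (v \in U).
Proof.
apply/eqP/idP => [v0 | Uv].
  by have := mem_sub_quot_proj v; rewrite v0 (_ : vsval _ = 0) ?subr0 // linear0.
apply: val_inj; apply/eqP; rewrite /= -memv0 -(capv_compl U) memv_cap subvsP andbT.
by rewrite -[vsval _](subKr v) rpredB ?mem_sub_quot_proj.
Qed.

Lemma quot_projM : ideal U ->
  forall u v, quot_proj (u • v) = (quot_proj u : quotient) • quot_proj v.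
Proof.
move=> idU u v; apply/eqP; rewrite -subr_eq0 /= /quot_mul -linearB quot_proj_eq0.
set u' := vsval _; set v' := vsval _.
have -> : u • v - u' • v' = (u - u') • v + u' • (v - v').
  by rewrite linearBl linearBr addrA subrK.
by apply: memvD; [apply: (idU _ _ _).2 | apply: (idU _ _ _).1]; apply: mem_sub_quot_proj.
Qed.

Lemma quot_formE (B : {symmetric g}) : (U <= orthov B fullv)%VS ->
  forall u v, quot_form B (quot_proj u) (quot_proj v) = B u v.
Proof.
move=> /orthovP BU u v; have BU' x y : y \in U -> B x y = 0.
  by move=> Uy; apply/eqP; rewrite herm_eq0C; apply/eqP/BU; rewrite ?memvf.
have cU w := mem_sub_quot_proj w.
have:= BU _ _ (cU u) (memvf v); rewrite linearBl => /subr0_eq ->.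
by have:= BU' (vsval (quot_proj u)) _ (cU v); rewrite linearBr => /subr0_eq ->.
Qed.

End Quotient.

Arguments quotient {R g} U.
Arguments quot_proj {R g} U.
Arguments quot_form {R g} U B.

Definition Lie (R : realType) (g : algebra R) : algebra R := quotient (Leib g).

Section Core.
Variables (R : realType) (g : algebra R) (B : {symmetric g}).

Definition core_ideal : {vspace g} := (Leib g :&: orthov B (Leib g))%VS.

Definition core_perp : {vspace g} := orthov B core_ideal.

Definition core_ideal_in_perp : {vspace sub_algebra core_perp} :=
  (linfun vsval @^-1: core_ideal)%VS.

Definition core_A : algebra R := quotient core_ideal_in_perp.

Definition core_A_form : {symmetric core_A} :=
  quot_form core_ideal_in_perp (sub_form core_perp B).

Definition core_h : algebra R := quotient core_perp.

End Core.

Lemma quotient_lie_algebra (R : realType) (g : algebra R) (U : {vspace g}) :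
  left_leibniz g -> ideal U -> (Leib g <= U)%VS -> lie_algebra (quotient U).
Proof.
move=> leibg idU sLU.
have qx (x : quotient U) : exists u, x = quot_proj U u.
  by exists (vsval x); rewrite quot_projK.
have mulC (x y : quotient U) : x • y + y • x = 0.
  have [[u ->] [v ->]] := (qx x, qx y).
  rewrite -!quot_projM // -linearD; apply/eqP; rewrite quot_proj_eq0.
  exact: (Leib_subP U).2.
have mulN (x y : quotient U) : x • y = - (y • x) by apply/eqP; rewrite -addr_eq0 mulC.
split=> [x | x y z].
  apply/eqP; have := mulC x x; rewrite -mulr2n -scaler_nat => /eqP.
  by rewrite scaler_eq0 Num.Theory.pnatr_eq0.
have leibq : x • (y • z) = (x • y) • z + y • (x • z).
  have [[u ->] [[v ->] [w ->]]] := (qx x, (qx y, qx z)).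
  by rewrite -!quot_projM // leibg linearD.
rewrite leibq (mulN z x) linearNr [z • _]mulN addrK.
by rewrite subrr.
Qed.

Section CoreFacts.
Variables (R : realType) (g : algebra R).

Lemma Leib_mul0 (u v : g) : left_leibniz g -> u \in Leib g -> u • v = 0.
Proof.
move=> leibg Lu; suff: (Leib g <= lker (linfun (applyr (amul g) v)))%VS.
  by move/subvP/(_ _ Lu); rewrite memv_ker lfunE /= => /eqP.
apply/Leib_subP => x y; rewrite memv_ker lfunE /= linearDl.
have E a b : (a • b) • v = a • (b • v) - b • (a • v).
  by rewrite (leibg a b v) addrK.
by rewrite !E addrA subrK subrr.
Qed.

Lemma Leib_ideal : left_leibniz g -> ideal (Leib g).
Proof.
move=> leibg u v Lv; rewrite (Leib_mul0 _ leibg Lv); split; last exact: mem0v.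
suff: (Leib g <= linfun (amul g u) @^-1: Leib g)%VS.
  by move/subvP/(_ _ Lv); rewrite -memv_preim lfunE.
apply/Leib_subP => x y; rewrite -memv_preim lfunE /= linearDr /= (leibg u x y) (leibg u y x).
have LP a b : a • b + b • a \in Leib g by apply: (Leib_subP _).2.
rewrite [u • y • x + _]addrC addrACA.
exact: memvD (LP (u • x) y) (LP x (u • y)).
Qed.

Variable B : {symmetric g}.

Lemma orthov_left_stable (U : {vspace g}) : L_quadratic B ->
  (forall u v, v \in U -> u • v \in U) ->
  forall u v, v \in orthov B U -> u • v \in orthov B U.
Proof.
move=> LB stU u v /mem_orthovP BUv; apply/mem_orthovP => w Uw.
by rewrite LB BUv ?oppr0 // stU.
Qed.

Lemma core_ideal_ideal : left_leibniz g -> L_quadratic B -> ideal (core_ideal B).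
Proof.
move=> leibg LB u v; rewrite memv_cap => /andP[Lv BLv].
rewrite (Leib_mul0 _ leibg Lv); split; last exact: mem0v.
rewrite memv_cap (Leib_ideal leibg _ Lv).1 /=.
exact: (orthov_left_stable LB (fun x y yL => (Leib_ideal leibg x yL).1)) BLv.
Qed.

Lemma core_perp_ideal : left_leibniz g -> L_quadratic B -> ideal (core_perp B).
Proof.
move=> leibg LB.
have stP := orthov_left_stable LB (fun x y yI => (core_ideal_ideal leibg LB x yI).1).
move=> u v Pv; split; first exact: stP.
rewrite -[v • u](addrK (u • v)); apply: memvB; last exact: stP.
have: v • u + u • v \in Leib g by apply: (Leib_subP _).2.
by apply/subvP; rewrite orthov_sym capvSr.
Qed.

Lemma Leib_sub_core_perp : (Leib g <= core_perp B)%VS.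
Proof. by rewrite orthov_sym capvSr. Qed.

Lemma core_ideal_in_perp_ideal :
  left_leibniz g -> L_quadratic B -> ideal (core_ideal_in_perp B).
Proof.
move=> leibg LB; have subP : subalgebra (core_perp B).
  by move=> x y _ /(core_perp_ideal leibg LB x)[].
move=> u v; rewrite -!memv_preim !lfunE /= => /(core_ideal_ideal leibg LB (vsval u)).
by rewrite -!(sub_algebraE _ _ subP).
Qed.

Lemma core_ideal_in_perp_radical :
  (core_ideal_in_perp B <= orthov (sub_form (core_perp B) B) fullv)%VS.
Proof.
apply/orthovP => u v; rewrite -memv_preim lfunE /= => Iu _.
have := subvsP v; rewrite /core_perp => /mem_orthovP BIv.
by apply/eqP; rewrite /= /restrict_form herm_eq0C BIv.
Qed.

End CoreFacts.

(* Main.v *)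
Require Import Defs.
From HB Require Import structures.
From mathcomp Require Import all_boot all_order all_algebra.
From mathcomp Require Import reals complex ring.

Set Implicit Arguments.
Unset Strict Implicit.
Unset Printing Implicit Defensive.

Import GRing.Theory Num.Theory.
Import VectorInternalTheory.
Local Open Scope ring_scope.

(** Write L for Leib g. Left multiplication by an element of L is zero, and a
    left-stable subspace that contains L is an ideal, because u • v + v • u lies
    in L.

    Assertion 1. The intersection I of L and its orthogonal is an ideal, so I is
    0, L or g. It is not g, since then L = g, which contains all products. If
    I = 0, then g is the direct sum of L and its orthogonal P; the subspace P is
    stable by left multiplications, squares of its elements lie in L and in P,
    hence vanish, and an ideal U of P gives the ideal L + U of g, so P is simple.
    If I = L, then P contains L and is itself an ideal, so P is 0, L or g
    (perp_Leib_cases); P = g would put L in the kernel of the metric. When L = P,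
    the core can be read off its definition.

    Assertion 2. Suppose that the metric B is R-quadratic, and take y in L. Then
    B(a • b, y) = - B(a, y • b) = 0, so the functional B(y, .) kills all
    products. It therefore suffices to know that g / L, being semisimple, is
    perfect. This is deduced from the trace form K(x, y) = tr(L_x L_y) on g,
    where L_x is left multiplication by x: once the radical of K is known to be L,
    the functional B(y, .), which kills L, has the form K(x, .); invariance of K
    turns K(x, g • g) = 0 into g • x <= L; the elements x with this property form
    a solvable ideal, so x is in L, and B(y, .) = K(x, .) = 0.

    That the radical of K is contained in L (killing_rad_sub_Leib) is Cartan's
    criterion, proved in two steps. For x in the span of the products of the
    radical with itself, L_x is nilpotent: over the complex numbers, let Y be the
    operator equal to the conjugate of a on the generalized eigenspace of L_x for
    a. As complex conjugation is additive, Y is a derivation, and this gives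
    tr(L_x Y) = 0; but this trace is the sum of the squared moduli of
    the eigenvalues of L_x (killing_rad_nilpotent). Engel's argument (engel) then
    produces, from an ideal of such elements larger than L, a solvable ideal not
    contained in L. *)

(** * Nilpotency of a matrix from the vanishing of a trace *)

Lemma coprimep_XsubC_exp_prod (F : fieldType) (b : F) (s : seq F) k :
  b \notin s ->
  coprimep (('X - b%:P) ^+ k) (\prod_(a <- s) ('X - a%:P) ^+ k).
Proof.
elim: s => [|a s IHs]; first by rewrite big_nil coprimep1.
rewrite inE negb_or big_cons coprimepMr => /andP[ba /IHs->]; rewrite andbT.
by apply/coprimep_expl/coprimep_expr; rewrite coprimep_XsubC root_XsubC eq_sym.
Qed.

(** The Chinese remainder theorem for powers of distinct linear factors; it turns
    an operator prescribed on generalized eigenspaces into a polynomial in the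
    given matrix. *)
Lemma poly_hermite_interpolation (F : fieldType) (s : seq F) (c : F -> F) k :
  uniq s ->
  exists q, forall a, a \in s -> ('X - a%:P) ^+ k %| q - (c a)%:P.
Proof.
elim: s => [_|b s IHs /= /andP[bs /IHs[q' Hq']]]; first by exists 0.
pose M := \prod_(a <- s) ('X - a%:P) ^+ k.
have /Bezout_eq1_coprimepP[[u v] /= uv1] : coprimep (('X - b%:P) ^+ k) M.
  exact: coprimep_XsubC_exp_prod.
exists (q' + ((c b)%:P - q') * (v * M)) => a; rewrite inE.
case/predU1P => [->|sa].
  have vM: v * M = 1 - u * ('X - b%:P) ^+ k by rewrite -uv1 addrC addKr.
  have ->: q' + ((c b)%:P - q') * (v * M) - (c b)%:P
           = (q' - (c b)%:P) * u * ('X - b%:P) ^+ k by rewrite vM; ring.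
  exact: dvdp_mulIr.
rewrite addrAC dvdp_add ?Hq' // mulrA dvdp_mull // /M (big_rem a) //=.
exact: dvdp_mulIl.
Qed.

Section TraceArgument.
Variables (C : numClosedFieldType) (n' : nat).
Local Notation n := n'.+1.
Implicit Types (X Y : 'M[C]_n) (v w : 'rV[C]_n) (p q : {poly C}).

Lemma trig_mul (A B : 'M[C]_n) : is_trig_mx A -> is_trig_mx B ->
  is_trig_mx (A *m B) /\ (forall i, (A *m B) i i = A i i * B i i).
Proof.
move=> /is_trig_mxP At /is_trig_mxP Bt; split=> [|i].
  apply/is_trig_mxP => i j ij; rewrite mxE big1 // => k _.
  have [ik|ki] := ltnP i k; first by rewrite At ?mul0r.
  by rewrite Bt ?mulr0 // (leq_ltn_trans ki).
rewrite mxE (bigD1 i) //= big1 ?addr0 // => k ki.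
have [ik|{}ki'] := ltnP i k; first by rewrite At ?mul0r.
by rewrite Bt ?mulr0 // ltn_neqAle ki' andbT.
Qed.

Lemma trig_horner (A : 'M[C]_n) p : is_trig_mx A ->
  is_trig_mx (horner_mx A p) /\ (forall i, horner_mx A p i i = p.[A i i]).
Proof.
move=> At; elim/poly_ind: p => [|p c [IHt IHd]].
  rewrite rmorph0; split=> [|i]; last by rewrite mxE horner0.
  by apply/is_trig_mxP => i j _; rewrite mxE.
have [Bt Bd] := trig_mul IHt At.
rewrite rmorphD rmorphM /= horner_mx_X horner_mx_C; split=> [|i].
  apply/is_trig_mxP => i j ij; rewrite mxE (is_trig_mxP _) // add0r mxE.
  by rewrite -val_eqE ltn_eqF.
by rewrite mxE [X in X + _]Bd IHd mxE eqxx hornerMXaddC.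
Qed.

(** In a triangular form of X with diagonal t, the matrix X q(X) has diagonal
    t_i q(t_i) = |t_i|^2, so the trace vanishes only if all t_i do. *)
Lemma nilpotent_of_trace_conj X q :
  (forall a, eigenvalue X a -> q.[a] = a^*) ->
  \tr (X *m horner_mx X q) = 0 -> X ^+ n = 0.
Proof.
move=> qconj; have [|P /unitarymx_unit Pu] := @Schur C n X; first by [].
rewrite /similar_to; set T := conjmx P X => Tt.
have XT : X = invmx P *m T *m P by rewrite /T conjumx // !mulmxA mulVmx // mul1mx mulmxKV.
have XTp p : horner_mx X p = invmx P *m horner_mx T p *m P.
  by rewrite XT horner_mx_uconjC.
have eigT i : eigenvalue X (T i i).
  apply: (@eigenvalue_conjmx _ _ _ P X).
  - exact: stablemx_unit.
  - by rewrite row_free_unit.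
  change (is_true (eigenvalue T (T i i))).
  rewrite eigenvalue_root_char char_poly_trig // /root horner_prod.
  by rewrite (bigD1 i) //= hornerXsubC subrr mul0r.
have -> : X *m horner_mx X q = horner_mx X ('X * q).
  by rewrite rmorphM /= horner_mx_X.
rewrite XTp mxtrace_mulC mulmxA mulmxV // mul1mx => tr0.
have T0 i : T i i = 0.
  apply/eqP; rewrite -normr_eq0 -sqrf_eq0 normCK; move: i (erefl true).
  have [_ Td] := trig_horner ('X * q) Tt.
  have ge0 i : true -> 0 <= T i i * (T i i)^* by rewrite mul_conjC_ge0.
  have: \sum_i T i i * (T i i)^* = 0.
    apply: (etrans _ tr0); apply: eq_bigr => i _.
    by rewrite Td hornerM hornerX qconj.
  by move/(psumr_eq0P ge0) => T0 i _; rewrite T0.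
have Tn : T ^+ n = 0.
  have := Cayley_Hamilton T; rewrite char_poly_trig //.
  under eq_bigr do rewrite T0 subr0.
  by rewrite prodr_const card_ord rmorphXn /= horner_mx_X.
have -> : X ^+ n = horner_mx X 'X^n by rewrite rmorphXn /= horner_mx_X.
by rewrite XTp rmorphXn /= horner_mx_X Tn mulmx0 mul0mx.
Qed.

Lemma horner_mx_dvd0 X v p q :
  p %| q -> v *m horner_mx X p = 0 -> v *m horner_mx X q = 0.
Proof.
move=> /dvdpP[u ->] vp0.
by rewrite mulrC rmorphM /= -mulmxE mulmxA vp0 mul0mx.
Qed.

Lemma horner_mx_XsubC_exp X a k : horner_mx X (('X - a%:P) ^+ k) = (X - a%:M) ^+ k.
Proof. by rewrite rmorphXn rmorphB /= horner_mx_X horner_mx_C. Qed.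

(** Generalized eigenvectors span the space: Bezout relations between the powers
    of the factors of the characteristic polynomial split any vector. *)
Lemma generalized_eigenvector_ind X (P : 'rV[C]_n -> Prop) :
  P 0 -> (forall v w, P v -> P w -> P (v + w)) ->
  (forall a v, eigenvalue X a -> v *m (X - a%:M) ^+ n = 0 -> P v) ->
  forall v, P v.
Proof.
move=> P0 PD Peig v.
have [r Xr] := closed_field_poly_normal (char_poly X).
rewrite (monicP (char_poly_monic X)) scale1r in Xr.
have szr : size r = n.
  by apply/succn_inj; rewrite -(size_char_poly X) Xr size_prod_XsubC.
have eigr a : a \in undup r -> eigenvalue X a.
  by rewrite mem_undup eigenvalue_root_char Xr root_prod_XsubC.
have : v *m horner_mx X (\prod_(a <- undup r) ('X - a%:P) ^+ n) = 0.
  apply: (@horner_mx_dvd0 _ _ (char_poly X)).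
    rewrite Xr -prodr_undup_exp_count.
    elim: (undup r) => [|a s IHs]; first by rewrite !big_nil dvdp1 size_poly1.
    by rewrite !big_cons dvdp_mul // dvdp_exp2l // -szr count_size.
  by rewrite Cayley_Hamilton mulmx0.
elim: (undup r) (undup_uniq r) eigr v => [_ _ v|b s IHs /=].
  by rewrite big_nil rmorph1 mulmx1 => ->.
move=> /andP[bs us] eigs v; rewrite big_cons => v0.
have /Bezout_eq1_coprimepP[[u w] /= uw1] := coprimep_XsubC_exp_prod n bs.
have -> : v = v *m horner_mx X (w * \prod_(a <- s) ('X - a%:P) ^+ n) +
              v *m horner_mx X (u * ('X - b%:P) ^+ n).
  by rewrite -mulmxDr -rmorphD /= addrC uw1 rmorph1 mulmx1.
have comb p q : v *m horner_mx X p *m horner_mx X q = v *m horner_mx X (p * q).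
  by rewrite -mulmxA mulmxE -rmorphM.
apply: PD.
  apply: (Peig b); first by apply: eigs; rewrite mem_head.
  rewrite -horner_mx_XsubC_exp comb; apply: horner_mx_dvd0 v0.
  by rewrite -mulrA [_ ^+ _ * _]mulrC dvdp_mulIr.
apply: IHs => //.
  by move=> a sa; apply: eigs; rewrite inE sa orbT.
by rewrite comb; apply: horner_mx_dvd0 v0; rewrite -mulrA dvdp_mulIr.
Qed.

(** The map L is the family of left multiplications (acting on row vectors) of a
    bilinear product v • w = w *m L v, and derX says that X is a derivation of
    this product. *)
Section Replica.
Variables (L : {linear 'rV[C]_n -> 'M[C]_n}) (X : 'M[C]_n).
Hypothesis derX : forall v, L v *m X - X *m L v = L (v *m X).

(** The operator X - (a + b) acts on a product by X - a on one factor plus X - b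
    on the other, so each application lowers one of the two exponents. *)
Lemma generalized_eigenvector_mul a b i j v w :
  v *m (X - a%:M) ^+ i = 0 -> w *m (X - b%:M) ^+ j = 0 ->
  (w *m L v) *m (X - (a + b)%:M) ^+ (i + j) = 0.
Proof.
move: {2}(i + j)%N (leqnn (i + j)) => k.
elim: k i j v w => [|k IHk] [|i] [|j] v w // lek v0 w0.
1-4: by move: v0 w0; rewrite ?expr0 ?mulmx1 => v0 w0;
        rewrite ?v0 ?w0 ?linear0 ?mul0mx ?mulmx0 ?mul0mx.
rewrite addSn addnS exprS -mulmxE mulmxA.
have -> : w *m L v *m (X - (a + b)%:M) =
          (w *m (X - b%:M)) *m L v + w *m L (v *m (X - a%:M)).
  rewrite !mulmxBr !mul_mx_scalar linearB linearZ /= -derX !mulmxBr mulmxBl.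
  rewrite -scalemxAl [L (_ *: _)]linearZ -scalemxAr !mulmxA scalerN scalerDl opprD.
  by rewrite addrA [RHS]addrC [X in _ = X + _]addrAC [RHS]addrA subrK.
have vw1 : w *m (X - b%:M) *m L v *m (X - (a + b)%:M) ^+ (i.+1 + j) = 0.
  apply: IHk => //; first by rewrite addSn -addnS -ltnS.
  by move: w0; rewrite exprS -mulmxE mulmxA.
have vw2 : w *m L (v *m (X - a%:M)) *m (X - (a + b)%:M) ^+ (i + j.+1) = 0.
  by apply: IHk => //; move: v0; rewrite exprS -mulmxE mulmxA.
by rewrite mulmxDl vw1 addnS in vw2 *; rewrite vw2 addr0.
Qed.

(** The operator q(X) that multiplies the generalized eigenvectors for a by the
    conjugate of a is again a derivation, since the weight of a product is the sum
    of the weights and conjugation is additive. *)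
Lemma conj_replica : exists q,
  (forall a, eigenvalue X a -> q.[a] = a^*) /\
  (forall v, L v *m horner_mx X q - horner_mx X q *m L v = L (v *m horner_mx X q)).
Proof.
have [r Xr] := closed_field_poly_normal (char_poly X).
rewrite (monicP (char_poly_monic X)) scale1r in Xr.
have eigr a : eigenvalue X a = (a \in r).
  by rewrite eigenvalue_root_char Xr root_prod_XsubC.
(* The sum of two eigenvalues need not be an eigenvalue, and a product of two
   generalized eigenvectors of exponent n is only known to have exponent n + n:
   the interpolation nodes and their multiplicities allow for both. *)
pose s := undup (r ++ [seq a + b | a <- r, b <- r]).
have [q Hq] := poly_hermite_interpolation Num.conj (n + n) (undup_uniq _ : uniq s).
have rs a : a \in r -> a \in s by rewrite mem_undup mem_cat => ->.
have Yeig a k v : a \in s -> (k <= n + n)%N -> v *m (X - a%:M) ^+ k = 0 ->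
    v *m horner_mx X q = a^* *: v.
  move=> /Hq qa lek v0; apply/eqP; rewrite -subr_eq0 -mul_mx_scalar -mulmxBr.
  rewrite -(horner_mx_C X) -rmorphB /=; apply/eqP.
  rewrite -horner_mx_XsubC_exp in v0; apply: horner_mx_dvd0 v0.
  by apply: dvdp_trans qa; rewrite dvdp_exp2l.
exists q; split=> [a|].
  rewrite eigr => /rs/Hq qa; apply/eqP; rewrite -subr_eq0.
  have /dvdp_trans/(_ qa) : 'X - a%:P %| ('X - a%:P) ^+ (n + n) by rewrite exprS dvdp_mulIl.
  by rewrite dvdp_XsubCl /root hornerD hornerN hornerC.
set Y := horner_mx X q.
apply: (@generalized_eigenvector_ind X).
- by rewrite !(mul0mx, linear0, oppr0, addr0).
- move=> v w IHv IHw; rewrite mulmxDl !linearD mulmxDl /= -IHv -IHw.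
  by rewrite addrACA.
(* The matrix identity is now tested on generalized eigenvectors w. *)
move=> a v ra v0; apply/row_matrixP => i; rewrite !rowE; move: (delta_mx _ _).
apply: (@generalized_eigenvector_ind X).
- by rewrite !mul0mx.
- by move=> w1 w2 IH1 IH2; rewrite !mulmxDl IH1 IH2.
move=> b w rb w0; rewrite !eigr in ra rb.
have Yv : v *m Y = a^* *: v by apply: (Yeig a n); rewrite ?rs ?leq_addr.
have Yw : w *m Y = b^* *: w by apply: (Yeig b n); rewrite ?rs ?leq_addr.
have Yvw : w *m L v *m Y = (a + b)^* *: (w *m L v).
  apply: (Yeig _ (n + n)%N) => //; last exact: generalized_eigenvector_mul.
  by rewrite mem_undup mem_cat; apply/orP; right; apply: allpairs_f.
rewrite mulmxBr !mulmxA Yvw Yw Yv linearZ /= -scalemxAl -scalemxAr.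
by rewrite rmorphD scalerDl addrK.
Qed.
End Replica.
End TraceArgument.

Lemma nilpotent_of_derivations (C : numClosedFieldType) (m : nat)
    (L : {linear 'rV[C]_m -> 'M[C]_m}) (X : 'M[C]_m) :
  (forall v, L v *m X - X *m L v = L (v *m X)) ->
  (forall Y, (forall v, L v *m Y - Y *m L v = L (v *m Y)) -> \tr (X *m Y) = 0) ->
  X ^+ m = 0.
Proof.
case: m => [|m] in L X *; first by rewrite !thinmx0.
move=> /conj_replica[q [qconj qder]] /(_ _ qder).
exact: nilpotent_of_trace_conj.
Qed.

(** * Ideals and products of left Leibniz algebras *)

Lemma prodg_ind (R : realType) (g : algebra R) (U V : {vspace g}) (P : g -> Prop) :
  P 0 -> (forall u v, P u -> P v -> P (u + v)) -> (forall a u, P u -> P (a *: u)) ->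
  (forall u v, u \in U -> v \in V -> P (u • v)) ->
  forall x, x \in prodg U V -> P x.
Proof.
move=> P0 PD PZ PM x /(coord_span (X := in_tuple _))->.
apply: big_ind => // i _; apply: PZ.
have /allpairsP[[u v] [/= Uu Vv ->]] :=
  mem_nth 0 (ltn_ord i : (i < size [seq u • v | u <- vbasis U, v <- vbasis V])%N).
by apply: PM; apply: vbasis_mem.
Qed.

Section LeibnizIdeals.
Variables (R : realType) (g : algebra R).
Implicit Types (u v : g) (W : {vspace g}).

Lemma mulC_mod_Leib u v W : (Leib g <= W)%VS -> u • v \in W -> v • u \in W.
Proof.
move=> LW uv; rewrite -[v • u](addrK (u • v)) memvB //.
by apply: (subvP LW); apply: (Leib_subP _).2.
Qed.

Lemma ideal_of_left_stable W : (Leib g <= W)%VS ->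
  (forall u v, v \in W -> u • v \in W) -> ideal W.
Proof.
move=> LW stW u v Wv; split; first exact: stW.
by apply: mulC_mod_Leib LW _; apply: stW.
Qed.

End LeibnizIdeals.

(** * The trace form and its radical *)

Lemma eq_mulmx_row m (F : fieldType) (A B : 'M[F]_m) :
  (forall r : 'rV_m, r *m A = r *m B) -> A = B.
Proof. by move=> AB; apply/row_matrixP => i; rewrite !rowE. Qed.

Section LeftMatrix.
Variables (R : realType) (g : algebra R).
Local Notation n := (dim g).
Implicit Types (u v w x : g).

(** Matrices act on row vectors, hence the order of the factors in lmul_mxM. *)
Definition lmul_mx u : 'M[R]_n := lin1_mx (v2r \o amul g u \o r2v).

Lemma mul_row_lmul_mx (r : 'rV_n) u : r *m lmul_mx u = v2r (u • r2v r).
Proof. by rewrite mul_rV_lin1. Qed.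

Lemma lmul_mx_is_linear : linear lmul_mx.
Proof.
move=> a u v; apply: eq_mulmx_row => r.
by rewrite mulmxDr -scalemxAr !mul_row_lmul_mx linearPl linearP.
Qed.
HB.instance Definition _ := GRing.isLinear.Build R g 'M[R]_n _ lmul_mx lmul_mx_is_linear.

Lemma lmul_mxM : left_leibniz g -> forall u v,
  lmul_mx (u • v) = lmul_mx v *m lmul_mx u - lmul_mx u *m lmul_mx v.
Proof.
move=> leibg u v; apply: eq_mulmx_row => r; rewrite mulmxBr !mulmxA !mul_row_lmul_mx !v2rK.
by rewrite leibg linearD addrK.
Qed.

Lemma mul_row_lmul_mx_iter x k v : iter k (amul g x) v = r2v (v2r v *m lmul_mx x ^+ k).
Proof.
elim: k => [|k IHk]; first by rewrite expr0 mulmx1 v2rK.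
by rewrite exprSr -mulmxE mulmxA mul_row_lmul_mx -IHk v2rK.
Qed.

Lemma lmul_mx_Leib x : left_leibniz g -> x \in Leib g -> lmul_mx x = 0.
Proof.
by move=> leibg Lx; apply: eq_mulmx_row => r; rewrite mulmx0 mul_row_lmul_mx Leib_mul0 ?linear0.
Qed.

Definition killing u v : R := \tr (lmul_mx u *m lmul_mx v).

Lemma killing_bilinear :
  bilinear_for (GRing.Scale.Law.clone _ _ *%R _)
    (GRing.Scale.Law.clone _ _ (idfun \; *%R) _) killing.
Proof.
split=> [y | x] a u v; rewrite /killing linearP /=.
  by rewrite mulmxDl -scalemxAl linearP.
by rewrite mulmxDr -scalemxAr linearP.
Qed.

HB.instance Definition _ := bilinear_isBilinear.Build R g g R
  _ _ killing killing_bilinear.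

Lemma killing_sym x y :
  killing x y = (-1) ^+ false * idfun (killing y x).
Proof. by rewrite expr0 mul1r /killing mxtrace_mulC. Qed.

HB.instance Definition _ := isHermitianSesquilinear.Build R g false
  idfun killing killing_sym.

Hypothesis leibg : left_leibniz g.

(** Invariance of the trace form: both sides are traces of a commutator of left
    multiplications times a third one. *)
Lemma killing_invl u v w : killing (u • v) w = - killing v (u • w).
Proof.
rewrite /killing !lmul_mxM // mulmxBr mulmxBl !linearB /= !mulmxA opprB; congr (_ - _).
by rewrite [RHS]mxtrace_mulC mulmxA.
Qed.

Definition killing_rad : {vspace g} := orthov (killing : {symmetric g}) fullv.

Lemma killing_radP x : reflect (forall y, killing x y = 0) (x \in killing_rad).
Proof.
apply: (iffP mem_orthovP) => [H y|H y _]; last exact: H.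
by apply: H; rewrite memvf.
Qed.

Lemma Leib_sub_killing_rad : (Leib g <= killing_rad)%VS.
Proof.
apply/subvP => x Lx; apply/killing_radP => y.
by rewrite /killing lmul_mx_Leib // mul0mx linear0.
Qed.

Lemma killing_rad_ideal : ideal killing_rad.
Proof.
apply: ideal_of_left_stable Leib_sub_killing_rad _ => u v /killing_radP Rv.
by apply/killing_radP => w; rewrite killing_invl Rv oppr0.
Qed.

Section Complexify.
Let C : numClosedFieldType := R[i].
Let inj : {rmorphism R -> C} := real_complex R.
Local Notation "A ^C" := (map_mx inj A) (at level 1, format "A ^C") : ring_scope.

(** The left multiplications of the complexification of g. *)
Definition lmul_mxC (z : 'rV[C]_n) : 'M[C]_n :=
  \sum_j z 0 j *: (lmul_mx (r2v (delta_mx 0 j)))^C.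

Lemma lmul_mxC_is_linear : linear lmul_mxC.
Proof.
move=> a y z; rewrite /lmul_mxC scaler_sumr -big_split; apply: eq_bigr => j _.
by rewrite !mxE scalerDl scalerA.
Qed.
HB.instance Definition _ := GRing.isLinear.Build C 'rV[C]_n 'M[C]_n _ lmul_mxC lmul_mxC_is_linear.

Lemma lmul_mxC_real u : lmul_mxC (v2r u)^C = (lmul_mx u)^C.
Proof.
rewrite -{2}[u]v2rK {2}(row_sum_delta (v2r u)) !linear_sum /= map_mx_sum.
by apply: eq_bigr => j _; rewrite !linearZ /= map_mxZ mxE.
Qed.

(** The Leibniz identity says that left multiplication by x is a derivation; it
    extends to the complexification by linearity. *)
Lemma lmul_mxC_der x z :
  lmul_mxC z *m (lmul_mx x)^C - (lmul_mx x)^C *m lmul_mxC z = lmul_mxC (z *m (lmul_mx x)^C).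
Proof.
have Ld j : lmul_mxC (delta_mx 0 j) = (lmul_mx (r2v (delta_mx 0 j)))^C.
  by rewrite -lmul_mxC_real r2vK map_delta_mx.
have lmul_mxCS F : lmul_mxC (\sum_(j < n) F j) = \sum_(j < n) lmul_mxC (F j) by apply: linear_sum.
have lmul_mxCZ a y : lmul_mxC (a *: y) = a *: lmul_mxC y by apply: linearZ.
rewrite (row_sum_delta z) lmul_mxCS !mulmx_suml mulmx_sumr -sumrB lmul_mxCS.
apply: eq_bigr => j _; rewrite -scalemxAl !lmul_mxCZ -scalemxAl -scalemxAr -scalerBr.
congr (_ *: _); rewrite Ld -!map_mxM -map_mxB -lmul_mxM //.
by rewrite -(map_delta_mx inj) -map_mxM mul_row_lmul_mx lmul_mxC_real.
Qed.

(** For a derivation Y and a, b in the radical, tr([L_a, L_b] Y) equals, up to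
    sign, tr(L_b L_(Y a)), which is zero because b is orthogonal for the trace
    form to the whole complexified algebra; nilpotent_of_derivations concludes. *)
Lemma killing_rad_nilpotent x : x \in prodg killing_rad killing_rad -> lmul_mx x ^+ n = 0.
Proof.
move=> Rx; apply: (@map_mx_inj _ _ inj); rewrite map_mx0.
have -> k : (lmul_mx x ^+ k)^C = (lmul_mx x)^C ^+ k.
  elim: k => [|k IHk]; first by rewrite !expr0 map_mx1.
  by rewrite !exprS -!mulmxE map_mxM IHk.
apply: (@nilpotent_of_derivations _ _ (@lmul_mxC)).
  exact: lmul_mxC_der.
move=> Y derY; elim/prodg_ind: x / Rx => [|u v|a u|a b Ra Rb].
- by rewrite linear0 map_mx0 mul0mx linear0.
- by move=> u0 v0; rewrite linearD map_mxD mulmxDl linearD /= u0 v0 addr0.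
- by move=> u0; rewrite linearZ map_mxZ -scalemxAl linearZ /= u0 mulr0.
rewrite lmul_mxM // map_mxB !map_mxM mulmxBl linearB /= -!mulmxA.
rewrite [X in _ - X]mxtrace_mulC -!mulmxA -linearB -mulmxBr.
rewrite -(lmul_mxC_real a) derY /=.
rewrite /lmul_mxC mulmx_sumr linear_sum big1 // => j _.
rewrite -scalemxAr linearZ /= -map_mxM (trace_map_mx inj).
by have /killing_radP := Rb; rewrite /killing => ->; rewrite rmorph0 mulr0.
Qed.
End Complexify.
End LeftMatrix.

(** * Linear forms and symmetric bilinear forms *)

(** For the Gram matrix G of K, the row of phi lies in the row space of G as soon
    as it annihilates the right kernel of G, which is the radical of K. *)
Lemma symmetric_form_represents (R : fieldType) (E : vectType R) (K : {symmetric E})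
    (phi : {linear E -> R^o}) :
  (forall u, u \in orthov K fullv -> phi u = 0) -> exists x, forall v, phi v = K x v.
Proof.
move=> phi0; pose e j := r2v (delta_mx 0 j) : E.
have eE v : v = \sum_j v2r v 0 j *: e j.
  rewrite -{1}[v]v2rK {1}(row_sum_delta (v2r v)) linear_sum.
  by apply: eq_bigr => j _; rewrite linearZ.
pose G := \matrix_(i, j) K (e i) (e j); pose c : 'rV[R]_(dim E) := \row_j (phi (e j) : R).
have KG u v : K u v = (v2r u *m G *m (v2r v)^T) 0 0.
  rewrite {1}[u]eE linear_sumlz -mulmxA mxE; apply: eq_bigr => i _.
  rewrite linearZl_LR /= mxE; congr (_ * _).
  rewrite {1}[v]eE linear_sumr; apply: eq_bigr => j _.
  by rewrite linearZr mxE /= mulrC !mxE.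
have phic v : phi v = (c *m (v2r v)^T) 0 0 :> R.
  rewrite {1}[v]eE linear_sum mxE; apply: eq_bigr => j _.
  by rewrite linearZ !mxE mulrC.
have /submxP[D cD] : (c <= G)%MS.
  rewrite submxE; apply/eqP/row_matrixP => i; rewrite ord1; apply/rowP => j.
  have mul_col m (A : 'M_(m, _)) : A *m col j (cokermx G) = col j (A *m cokermx G).
    by rewrite !colE mulmxA.
  have rad_w : r2v (col j (cokermx G))^T \in orthov K fullv.
    apply/mem_orthovP => v _; apply/eqP; rewrite herm_eq0C KG r2vK trmxK.
    by rewrite -mulmxA mul_col mulmx_coker !mxE big1 // => k _; rewrite !mxE mulr0.
  by have := phi0 _ rad_w; rewrite phic r2vK trmxK mul_col !mxE.
by exists (r2v D) => v; rewrite phic cD KG r2vK.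
Qed.

(** The component of u along L is the vector of L that represents the restriction
    of B(u, .) for the restricted form, whose radical is 0. *)
Lemma nondegenerate_subspace_sum (R : realType) (g : algebra R) (B : {symmetric g})
    (L : {vspace g}) :
  nondegenerate_subspace B L -> (L + orthov B L = fullv)%VS.
Proof.
move=> ndL; apply/eqP; rewrite eqEsubv subvf; apply/subvP => u _.
have [|x xB] := @symmetric_form_represents _ _ (@restrict_form R g B L) (B u \o vsval).
  move=> /= l /mem_orthovP rad_l.
  suff -> : vsval l = 0 by rewrite linear0.
  apply/eqP; rewrite -memv0 -ndL memv_cap subvsP; apply/mem_orthovP => v Lv.
  by have := rad_l (vsproj L v) (memvf _); rewrite /= /restrict_form vsprojK.
rewrite -[u](subrK (vsval x)) addrC memv_add ?subvsP //.
apply/mem_orthovP => v Lv; rewrite linearBl /=.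
have := xB (vsproj L v); rewrite /= /restrict_form vsprojK // => ->.
by rewrite subrr.
Qed.

(** * Engel's theorem and Cartan's criterion *)

Section Leibniz.
Variables (R : realType) (g : algebra R).
Implicit Types (u v w x y : g) (U V W H M : {vspace g}).

Definition transporter H W : {vspace g} :=
  (\bigcap_(i < \dim H) (linfun (amul g (vbasis H)`_i) @^-1: W))%VS.

Lemma mem_transporter H W u :
  reflect (forall h, h \in H -> h • u \in W) (u \in transporter H W).
Proof.
apply: (iffP idP) => [uT h Hh|HW].
  rewrite (coord_vbasis Hh) linear_sumlz; apply: memv_suml => i _.
  rewrite linearZl_LR; apply: memvZ.
  move: uT => /(subvP (bigcapv_inf i isT (subvv _))).
  by rewrite -memv_preim lfunE.
rewrite memvE; apply/subv_bigcapP => i _; rewrite -memvE -memv_preim lfunE /=.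
by apply/HW/vbasis_mem/mem_nth; rewrite size_tuple.
Qed.

Hypothesis leibg : left_leibniz g.

Lemma square_in_Leib u : u • u \in Leib g.
Proof.
have : u • u + u • u \in Leib g by apply: (Leib_subP _).2.
rewrite -mulr2n -scaler_nat => /(memvZ 2^-1).
by rewrite scalerA mulVf ?scale1r ?pnatr_eq0.
Qed.

Definition left_nilpotent x := exists k, forall v, iter k (amul g x) v = 0.

Definition stable H V := forall h v, h \in H -> v \in V -> h • v \in V.

(** The conclusion of Engel's theorem for the action of M on the quotients of
    subspaces of g, written without quotients: a nonzero class of V modulo W is
    killed by M. *)
Definition has_invariants M := forall V W, stable M V -> stable M W ->
  ~~ (V <= W)%VS -> exists v, [/\ v \in V, v \notin W & forall h, h \in M -> h • v \in W].

(** The vectors of V sent into W by M are stable by y, since M normalizes y; as y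
    acts nilpotently, the last iterate of such a vector under y outside W is
    killed modulo W by y as well. *)
Lemma has_invariants_grow M y : (Leib g <= M)%VS -> subalgebra M ->
  left_nilpotent y -> (forall m, m \in M -> m • y \in M) -> has_invariants M ->
  subalgebra (M + <[y]>) /\ has_invariants (M + <[y]>).
Proof.
move=> LM sM [k yk] My invM; split.
  move=> _ _ /memv_addP[m Mm [_ /vlineP[a ->] ->]] /memv_addP[m' Mm' [_ /vlineP[b ->] ->]].
  apply: (subvP (addvSl _ _)).
  rewrite linearDl !linearDr !linearZl_LR !linearZr.
  have yy : y • y \in M by apply: (subvP LM); apply: square_in_Leib.
  have ym : y • m' \in M by apply: mulC_mod_Leib LM _; apply: My.
  have [mm' my] := (sM _ _ Mm Mm', My _ Mm).
  by rewrite !memvD //=; do ?apply: memvZ.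
move=> V W sV sW VW.
have sMM h : h \in M -> h \in (M + <[y]>)%VS by apply/subvP/addvSl.
have My' : y \in (M + <[y]>)%VS by apply: (subvP (addvSr _ _)); apply: memv_line.
have [||v [Vv Wv vW]] := invM V W _ _ VW.
- by move=> h v /sMM; apply: sV.
- by move=> h v /sMM; apply: sW.
have itV j : iter j (amul g y) v \in V by elim: j => //= j; apply: sV.
have itM j m : m \in M -> m • iter j (amul g y) v \in W.
  elim: j m => [|j IHj] m Mm /=; first exact: vW.
  by rewrite leibg memvD ?IHj ?My // sW ?IHj.
have exj : exists j, iter j (amul g y) v \in W by exists k; rewrite yk mem0v.
case: (ex_minnP exj) => [[|j] jW jmin]; first by rewrite /= (negPf Wv) in jW.
exists (iter j (amul g y) v); split=> //.
  by apply/negP => /jmin; rewrite ltnn.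
move=> _ /memv_addP[m Mm [_ /vlineP[a ->] ->]].
by rewrite linearDl linearZl_LR memvD ?itM // memvZ.
Qed.

(** A subalgebra M of H satisfying has_invariants grows from Leib g, which acts by
    zero, up to H: has_invariants M for the pair H, M gives a new y in H with
    M • y in M, and has_invariants_grow adds it to M. *)
Lemma engel H : (Leib g <= H)%VS -> subalgebra H ->
  (forall x, x \in H -> left_nilpotent x) -> has_invariants H.
Proof.
move=> LH sH nilH.
(* A subalgebra of dimension larger than that of H cannot be contained in H, so
   the growth stops at H. *)
suff grow d : exists M, [/\ (Leib g <= M)%VS, (M <= H)%VS, subalgebra M & has_invariants M] /\
   ((H <= M)%VS || (d <= \dim M)%N).
  have [M [[LM MH sM invM]]] := grow (\dim H).+1.
  rewrite orbC ltnNge dimvS //= => HM.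
  by have -> : H = M by apply/eqP; rewrite eqEsubv HM MH.
elim: d => [|d [M [[LM MH sM invM]]]].
  exists (Leib g); rewrite orbT subvv; split=> //; split=> //.
    by move=> u v Lu Lv; rewrite Leib_mul0 ?mem0v.
  move=> V W _ _ /subvPn[v Vv Wv]; exists v; split=> // h Lh.
  by rewrite Leib_mul0 ?mem0v.
have [HM _|HM /= dM] := boolP (H <= M)%VS; first by exists M; rewrite HM.
have [|y [Hy My yM]] := invM H M _ sM HM.
  by move=> h v /(subvP MH); apply: sH.
have [sM' invM'] := has_invariants_grow LM sM (nilH y Hy) yM invM.
exists (M + <[y]>)%VS; split; first split=> //.
- by apply: subv_trans LM (addvSl _ _).
- by rewrite subv_add MH -memvE.
apply/orP; right; apply: (leq_ltn_trans dM); rewrite ltnNge.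
apply: contra My => dMy; have /eqP -> : M == (M + <[y]>)%VS by rewrite eqEdim addvSl.
by rewrite memvE addvSr.
Qed.

Hypothesis ssg : semisimple_algebra g.

(** Such an ideal is solvable, because products of elements of Leib g vanish. *)
Lemma ideal_sub_Leib V : ideal V -> (forall u v, u \in V -> v \in V -> u • v \in Leib g) ->
  (V <= Leib g)%VS.
Proof.
move=> idV VL; have [_ _] := ssg; apply=> //; exists 2; apply/eqP.
rewrite /= -subv0; apply/prodg_subP => u v Vu _.
by rewrite Leib_mul0 ?mem0v //; move/prodg_subP/subvP: VL; apply.
Qed.

(** Leib g and the products of the radical with itself span an ideal N that acts
    by nilpotent operators. If N were larger than Leib g, Engel's theorem would
    give an element of N outside Leib g which N sends into Leib g; but the elements
    of N sent into Leib g by N form an ideal with square in Leib g, which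
    semisimplicity confines to Leib g. So N = Leib g, and the radical is itself an
    ideal with square in Leib g. *)
Lemma killing_rad_sub_Leib : (killing_rad g <= Leib g)%VS.
Proof.
have idR := killing_rad_ideal leibg.
pose N := (prodg (killing_rad g) (killing_rad g) + Leib g)%VS.
have LN : (Leib g <= N)%VS := addvSr _ _.
have idN : ideal N.
  apply: ideal_of_left_stable LN _ => // u _ /memv_addP[v Rv [l Ll ->]].
  rewrite linearDr memv_add //; last exact: (Leib_ideal leibg u Ll).1.
  elim/prodg_ind: v / Rv => [|v w|a v|a b Ra Rb].
  - by rewrite linear0 mem0v.
  - by rewrite linearDr; apply: memvD.
  - by rewrite linearZr; apply: memvZ.
  have RR := (prodg_subP _ _ _).2 (subvv (prodg (killing_rad g) (killing_rad g))).
  by rewrite leibg memvD ?RR //; apply: (idR _ _ _).1.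
have nilN x : x \in N -> left_nilpotent x.
  case/memv_addP=> r Rr [l Ll ->]; exists (dim g) => v.
  rewrite mul_row_lmul_mx_iter linearD /= (lmul_mx_Leib leibg Ll) addr0.
  by rewrite killing_rad_nilpotent // mulmx0 linear0.
have sN : subalgebra N by move=> u v _ /(idN u)[].
suff NL : (N <= Leib g)%VS.
  apply: ideal_sub_Leib => // u v; move: u v; apply/prodg_subP.
  exact: subv_trans (addvSl _ _) NL.
apply: contraT => NL; have [||v [Nv Lv NvL]] := engel LN sN nilN _ _ NL.
- by move=> h u _ /(idN h)[].
- by move=> h u _ /(Leib_ideal leibg h)[].
pose Z := (N :&: transporter N (Leib g))%VS.
suff /subvP/(_ v) : (Z <= Leib g)%VS.
  by rewrite (negPf Lv) memv_cap Nv => -> //; apply/mem_transporter.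
apply: ideal_sub_Leib => [|u w].
  apply: ideal_of_left_stable => //.
    rewrite subv_cap LN; apply/subvP => u Lu; apply/mem_transporter => h _.
    exact: (Leib_ideal leibg h Lu).1.
  move=> u w /memv_capP[Nw /mem_transporter Tw]; rewrite memv_cap (idN u w Nw).1.
  apply/mem_transporter => h Nh; rewrite leibg memvD //.
    by apply: Tw; apply: (idN _ _ _).2.
  by apply: (Leib_ideal leibg _ _).1; apply: Tw.
by move=> /memv_capP[Nu _] /memv_capP[_ /mem_transporter]; apply.
Qed.

(** For y in Leib g, the functional B(y, .) kills all products, so it is K(x, .)
    for the trace form K and some x, and invariance of K places x in Leib g. *)
Lemma R_quadratic_Leib0 (B : {symmetric g}) : nondegenerate B -> R_quadratic B ->
  Leib g = 0%VS.
Proof.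
move=> /eqP B0 RB; apply/eqP; rewrite -subv0; apply/subvP => y Ly.
have By a b : B y (a • b) = 0.
  apply/eqP; rewrite herm_eq0C RB (Leib_mul0 b leibg Ly).
  by rewrite linear0 oppr0.
have [|x xB'] := @symmetric_form_represents _ _ (@killing R g) (B y).
  move=> u /(subvP killing_rad_sub_Leib); suff: (Leib g <= orthov B <[y]>)%VS.
    by move=> /subvP H /H; rewrite mem_orthov1 herm_eq0C => /eqP.
  apply/Leib_subP => a b; by rewrite mem_orthov1 herm_eq0C linearDr /= !By addr0.
have xB v : B y v = killing x v := xB' v.
pose T := transporter fullv (Leib g).
have TL : (T <= Leib g)%VS.
  have LT : (Leib g <= T)%VS.
    by apply/subvP => u Lu; apply/mem_transporter => h _; apply: (Leib_ideal leibg h Lu).1.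
  apply: ideal_sub_Leib => [|? ? _ /mem_transporter]; last by apply; apply: memvf.
  apply: ideal_of_left_stable LT _ => u w /mem_transporter Tw; apply/mem_transporter => h _.
  by apply: (Leib_ideal leibg _ _).1; apply: Tw; apply: memvf.
have Rx : x \in killing_rad g.
  apply: (subvP (Leib_sub_killing_rad leibg)); apply: (subvP TL); apply/mem_transporter => h _.
  apply: (subvP killing_rad_sub_Leib); apply/killing_radP => z; rewrite killing_invl //.
  by rewrite -xB By oppr0.
rewrite -B0; apply/mem_orthovP => z _; rewrite xB.
by have /killing_radP -> := Rx.
Qed.

Lemma R_quadratic_semisimple_quadratic (B : {symmetric g}) :
  nondegenerate B -> R_quadratic B -> quadratic_lie_algebra B.
Proof.
move=> ndB RB; have L0 := R_quadratic_Leib0 ndB RB.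
have mulC u v : u • v = - (v • u).
  apply/eqP; rewrite -addr_eq0 -memv0 -L0; exact: (Leib_subP _).2.
split=> // [|u v w].
  split=> [u|u v w]; first by apply/eqP; rewrite -memv0 -L0 square_in_Leib.
  by rewrite leibg (mulC w u) linearNr [w • (_ • _)]mulC addrK subrr.
by rewrite mulC linearNl /= RB opprK [X in B _ X]mulC linearNr.
Qed.
End Leibniz.

(** * Simple L-quadratic algebras *)

Section SimpleLeibniz.
Variables (R : realType) (g : algebra R) (B : {symmetric g}).
Hypotheses (leibg : left_leibniz g) (ndB : nondegenerate B) (LB : L_quadratic B).
Hypothesis simpg : simple_algebra g.
Local Notation L := (Leib g).
Local Notation P := (orthov B L).

Lemma simple_not_mul_in_Leib : ~ (forall u v : g, u • v \in L).
Proof.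
move=> gL; have [_ /eqP/negP] := simpg; apply.
rewrite eqEsubv; apply/andP; split; first by apply/prodg_subP.
apply/Leib_subP => u v.
by apply: memvD; apply: (prodg_subP _ _ _).2 (subvv _) _ _ _ _; apply: memvf.
Qed.

Lemma perp_Leib_subalgebra : subalgebra P.
Proof.
move=> u v _; apply: orthov_left_stable => // x y.
by move=> /(Leib_ideal leibg x)[].
Qed.

Section Nondegenerate.
Hypothesis ndL : nondegenerate_subspace B L.
Local Notation H := (sub_algebra P).

Let LP0 u : u \in L -> u \in P -> u = 0.
Proof. by move=> Lu Pu; apply/eqP; rewrite -memv0 -ndL memv_cap Lu. Qed.

Let subLP0 (x : H) : vsval x \in L -> x = 0.
Proof. by move=> Lx; apply: subvs_inj; rewrite (LP0 Lx (subvsP x)) linear0. Qed.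

Let sumLP u : exists l p : g, [/\ l \in L, p \in P & u = l + p].
Proof.
have := memvf u; rewrite -(nondegenerate_subspace_sum ndL).
by case/memv_addP=> l Ll [p Pp ->]; exists l, p.
Qed.

(** Symmetrized products of elements of P lie both in Leib g and in P. *)
Lemma perp_Leib_lie : lie_algebra H.
Proof.
have vM := fun x y : H => sub_algebraE x y perp_Leib_subalgebra.
have mulC (x y : H) : x • y = - (y • x).
  apply/eqP; rewrite -addr_eq0; apply/eqP/subLP0; rewrite linearD.
  change (vsval (x • y) + vsval (y • x) \in L).
  by rewrite !vM; apply: (Leib_subP _).2.
have leibH (x y z : H) : x • (y • z) = x • y • z + y • (x • z).
  apply: subvs_inj; rewrite linearD; change (vsval (x • (y • z)) =
    vsval (x • y • z) + vsval (y • (x • z))); by rewrite !vM leibg.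
split=> [x|x y z].
  apply/eqP; have := mulC x x => /eqP; rewrite -addr_eq0 -mulr2n -scaler_nat.
  by rewrite scaler_eq0 pnatr_eq0.
by rewrite leibH (mulC z x) linearNr [z • _]mulC addrK subrr.
Qed.

Lemma perp_Leib_quadratic : quadratic_lie_algebra (sub_form P B).
Proof.
split; first exact: perp_Leib_lie.
  apply/eqP/eqP; rewrite -subv0; apply/subvP => x /mem_orthovP xB.
  rewrite memv0; apply/eqP/subLP0; apply: (subvP (sub0v _)).
  rewrite -(eqP ndB); apply/mem_orthovP => u _.
  have [l [p [Ll Pp ->]]] := sumLP u; rewrite linearDr /=.
  have /mem_orthovP/(_ l Ll) -> := subvsP x; rewrite add0r.
  by have := xB (vsproj P p) (memvf _); rewrite /= /restrict_form vsprojK.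
move=> u v w; rewrite /= /restrict_form.
by rewrite !(sub_algebraE _ _ perp_Leib_subalgebra) LB.
Qed.

(** If U is an ideal of P, then Leib g + U is an ideal of g, since Leib g acts by
    zero from the left; and P • P = 0 would force g • g to be in Leib g. *)
Lemma perp_Leib_simple : simple_algebra H.
Proof.
have vM := fun x y : H => sub_algebraE x y perp_Leib_subalgebra.
have [H2 _] := perp_Leib_lie.
have LH0 : Leib H = 0%VS.
  apply/eqP; rewrite -subv0; apply/Leib_subP => x y.
  have := H2 (x + y); rewrite linearDl !linearDr !H2 /= addr0 add0r => ->.
  by rewrite mem0v.
rewrite /simple_algebra LH0; split=> [U idU|HH0]; last first.
  apply: simple_not_mul_in_Leib => u v.
  have [l [p [Ll Pp ->]]] := sumLP u; have [l' [p' [Ll' Pp' ->]]] := sumLP v.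
  rewrite linearDl (Leib_mul0 _ leibg Ll) add0r linearDr memvD //.
    exact: (Leib_ideal leibg p Ll').1.
  have := (prodg_subP _ _ _).2 (subvv (prodg fullv fullv))
            (vsproj P p : H) (vsproj P p' : H) (memvf _) (memvf _).
  rewrite HH0 memv0 => /eqP/(congr1 vsval); rewrite vM !vsprojK // linear0 => ->.
  exact: mem0v.
pose U' : {vspace g} := (linfun vsval @: U)%VS.
have memU' (x : H) : x \in U -> vsval x \in U'.
  by move=> Ux; have := memv_img (linfun vsval) Ux; rewrite lfunE.
have U'P u : u \in U' -> exists2 x : H, x \in U & u = vsval x.
  by case/memv_imgP=> x Ux ->; exists x; rewrite ?lfunE.
have idLU : ideal (L + U')%VS.
  apply: ideal_of_left_stable; first exact: addvSl.
  move=> u _ /memv_addP[l Ll [_ /U'P[x Ux ->] ->]].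
  rewrite linearDr; apply: memv_add; first exact: (Leib_ideal leibg u Ll).1.
  have [l' [p [Ll' Pp ->]]] := sumLP u.
  rewrite linearDl (Leib_mul0 _ leibg Ll') add0r.
  by rewrite -(vsprojK Pp) -(vM (vsproj P p)) memU' //; apply: (idU _ _ Ux).1.
have U0 : (U' <= L)%VS -> U = 0%VS.
  move=> U'L; apply/eqP; rewrite -subv0; apply/subvP => x Ux.
  by rewrite memv0; apply/eqP/subLP0/(subvP U'L)/memU'.
have [LU|LU|LU] := simpg.1 _ idLU.
- by constructor 1; apply: U0; rewrite (subv_trans (addvSr L _)) // LU sub0v.
- by constructor 1; apply: U0; rewrite -LU addvSr.
constructor 3; apply/eqP; rewrite eqEsubv subvf; apply/subvP => x _.
have := memvf (vsval x); rewrite -LU => /memv_addP[l Ll [_ /U'P[y Uy ->] xly]].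
suff -> : x = y by [].
apply: val_inj => /=; rewrite xly [l]LP0 ?add0r //.
have -> : l = vsval x - vsval y by rewrite xly addrK.
by rewrite memvB ?subvsP.
Qed.
End Nondegenerate.

Lemma perp_Leib_cases : nondegenerate_subspace B L \/ L = P.
Proof.
have [I0|IL|If] := simpg.1 _ (core_ideal_ideal leibg LB).
- by left.
- have LP : (L <= P)%VS by rewrite -[X in (X <= _)%VS]IL; exact: capvSr.
  have idP : ideal P.
    apply: ideal_of_left_stable LP _ => u v.
    by apply: orthov_left_stable => // x y /(Leib_ideal leibg x)[].
  have [P0|->|Pf] := simpg.1 _ idP; [|by right|].
    by right; apply/eqP; rewrite eqEsubv LP P0 sub0v.
  left; rewrite /nondegenerate_subspace; apply/eqP; rewrite -subv0.
  apply: subv_trans (capvSl _ _) _; rewrite -(eqP ndB).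
  by rewrite orthov_sym Pf subvf.
case: simple_not_mul_in_Leib => u v; rewrite (_ : L = fullv) ?memvf //.
by apply/eqP; rewrite eqEsubv subvf -If capvSl.
Qed.

Lemma core_A_eq0 : L = P -> forall a : core_A B, a = 0.
Proof.
move=> LP a; rewrite -[a](@quot_projK _ (sub_algebra (core_perp B))).
apply/eqP; rewrite quot_proj_eq0 -memv_preim lfunE /=.
have := subvsP (vsval a : subvs_of (core_perp B)); move: (vsval (vsval a)) => u.
by rewrite /core_perp /core_ideal -LP capvv -LP.
Qed.

Lemma core_h_Lie : L = P ->
  exists f : 'Hom(core_h B, Lie g),
    [/\ bijective f, (forall x y, f (x • y) = f x • f y) &
        forall u, f (quot_proj (core_perp B) u) = quot_proj L u].
Proof.
move=> LP; have : core_perp B = L by rewrite /core_perp /core_ideal -LP capvv -LP.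
rewrite /core_h /Lie; move: (core_perp B) => Q ->.
exists \1%VF; split=> [|x y|u]; last by rewrite id_lfunE.
  by exists id => x; rewrite /= id_lfunE.
by rewrite !id_lfunE.
Qed.
End SimpleLeibniz.

Theorem proposition4p6 (R : realType) (g : algebra R) (B : {symmetric g})
    (leibg : left_leibniz g) (metricB : nondegenerate B) :
  (L_quadratic B -> simple_algebra g ->
     [/\ Leib g = orthov B (Leib g),
         (forall a : core_A B, a = 0) &
         exists f : 'Hom(core_h B, Lie g),
           [/\ bijective f, (forall x y, f (x • y) = f x • f y) &
               forall u, f (quot_proj (core_perp B) u) = quot_proj (Leib g) u]]
     \/
     [/\ nondegenerate_subspace B (Leib g),
         subalgebra (orthov B (Leib g)),
         simple_algebra (sub_algebra (orthov B (Leib g))),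
         quadratic_lie_algebra (sub_form (orthov B (Leib g)) B) &
         (Leib g + orthov B (Leib g) = fullv)%VS /\
         directv (Leib g + orthov B (Leib g))])
  /\
  (R_quadratic B -> semisimple_algebra g -> quadratic_lie_algebra B).
Proof.
split=> [LB simpg|RB ssg]; last exact: R_quadratic_semisimple_quadratic.
have [ndL|LP] := perp_Leib_cases leibg metricB LB simpg; [right | left].
  split=> //.
  - exact: perp_Leib_subalgebra.
  - exact: perp_Leib_simple.
  - exact: perp_Leib_quadratic.
  by split; [apply: nondegenerate_subspace_sum | apply/directv_addP].
by split=> //; [apply: core_A_eq0 | apply: core_h_Lie].
Qed.
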